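(* Let $X$ be a countable set, let $k:X\times X\to[0,\infty)$ be a symmetric summable kernel, let $p\in(1,\infty)$ and $\Omega\subseteq X$. Let $h:X\to[0,\infty)$ satisfy $h>0$ on $\Omega$ and $h=0$ on $X\setminus\Omega$. Suppose that $h,h^{p-1}\in\mathcal F_k(X)$ and that both functions are superharmonic on $\Omega$. Then, for every $u\in\ell^p(\Omega,\mu_h)$, $$\mathcal E_p^{X,k}(u)=\sum_{x\in\Omega}w_h(x)|u(x)|^p+\frac1p\sum_{x,y\in\Omega}F_p\left(\frac{u(x)}{h(x)},\frac{u(y)}{h(y)}\right)h(x)^{p-1}h(y)k(x,y),$$ where $$w_h(x):=\frac1{p'}\frac{L_kh(x)}{h(x)}+\frac1p\frac{L_kh^{p-1}(x)}{h(x)^{p-1}},\qquad x\in\Omega,$$ the identity being understood in $[0,\infty]$. Moreover, $w_h$ is a Hardy weight for $\mathcal E_p^{X,k}$ on $\Omega$ and $$\mathcal E_p^{X,k}(u)\geq\sum_{x\in\Omega}w_h(x)|u(x)|^p,\qquad u\in\ell^p(\Omega,\mu_h).$$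
   Context: A kernel $k:X\times X\to[0,\infty)$ is symmetric if $k(x,y)=k(y,x)$, and summable if $\sum_{y\in X}k(x,y)<\infty$ for every $x\in X$. $p'=p/(p-1)$. For $a\in\mathbb R$, $\beta>0$: $a^{\langle\beta\rangle}:=|a|^\beta\operatorname{sgn}a$. Sobolev--Bregman form, for $u:X\to\mathbb R$: $$\mathcal E_p^{X,k}(u):=\frac12\sum_{x\in X}\sum_{y\in X}(u(x)-u(y))\bigl(u(x)^{\langle p-1\rangle}-u(y)^{\langle p-1\rangle}\bigr)k(x,y)\in[0,\infty].$$ Bregman divergence: $F_p(a,b):=|b|^p-|a|^p-pa^{\langle p-1\rangle}(b-a)\ge0$, $a,b\in\mathbb R$. $\mathcal F_k(X):=\{u:X\to\mathbb R:\ \sum_{y\in X}k(x,y)|u(y)|<\infty\text{ for every }x\in X\}$, and $L_ku(x):=\sum_{y\in X}(u(x)-u(y))k(x,y)$ for $u\in\mathcal F_k(X)$, $x\in X$. A function $u\in\mathcal F_k(X)$ is superharmonic on $\Omega$ if $L_ku(x)\ge0$ for all $x\in\Omega$. For $h$ as in the claim, for $x\in\Omega$, $$\mu_h(x):=\frac1{p'}\frac1{h(x)}\sum_{y\in X}|h(x)-h(y)|k(x,y)+\frac1p\frac1{h(x)^{p-1}}\sum_{y\in X}|h(x)^{p-1}-h(y)^{p-1}|k(x,y).$$ For $\mu:\Omega\to[0,\infty)$, $\ell^p(\Omega,\mu)$ is the set of $u:X\to\mathbb R$ with $u=0$ on $X\setminus\Omega$ and $\sum_{x\in\Omega}|u(x)|^p\mu(x)<\infty$.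 $C_c(\Omega)$ is the set of finitely supported functions on $\Omega$, extended by zero to $X\setminus\Omega$. A Hardy weight for $\mathcal E_p^{X,k}$ on $\Omega$ is a function $w:\Omega\to[0,\infty)$ such that $\mathcal E_p^{X,k}(u)\ge\sum_{x\in\Omega}w(x)|u(x)|^p$ for all $u\in C_c(\Omega)$. *)

(* Defs.v *)
From HB Require Import structures.
From mathcomp Require Import all_boot all_order all_algebra.
From mathcomp Require Import all_classical all_reals all_analysis.

Set Implicit Arguments.
Unset Strict Implicit.
Unset Printing Implicit Defensive.

Import Order.TTheory GRing.Theory Num.Theory.

Local Open Scope classical_set_scope.
Local Open Scope ring_scope.

Section Defs.
Variables (R : realType) (X : countType).
Implicit Types (p a b : R) (k : X -> X -> R) (u h mu w : X -> R)
  (Omega : set X).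

(* Sum over X of an absolutely summable real family; it is a junk value when
   the family is not absolutely summable. *)
Definition sumX (f : X -> R) : R :=
  fine (\esum_(y in [set: X]) (EFin \o f)^\+ y)%E
  - fine (\esum_(y in [set: X]) (EFin \o f)^\- y)%E.

Definition conj_exponent p : R := p / (p - 1).

Definition spow a (beta : R) : R := `|a| `^ beta * Num.sg a.

Definition kernel_nonneg k : Prop := forall x y, 0 <= k x y.

Definition kernel_symmetric k : Prop := forall x y, k x y = k y x.

Definition kernel_summable k : Prop :=
  forall x, summable [set: X] (fun y => (k x y)%:E).

(* The terms are nonnegative because a |-> spow a (p - 1) is nondecreasing. *)
Definition SB_form p k u : \bar R :=
  ((2^-1)%:E * \esum_(x in [set: X]) \esum_(y in [set: X])
     ((u x - u y) * (spow (u x) (p - 1) - spow (u y) (p - 1)) * k x y)%:E)%E.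

Definition Bregman p a b : R :=
  `|b| `^ p - `|a| `^ p - p * spow a (p - 1) * (b - a).

Definition formal_dom k u : Prop :=
  forall x, summable [set: X] (fun y => (k x y * `|u y|)%:E).

Definition formal_lap k u (x : X) : R :=
  sumX (fun y => (u x - u y) * k x y).

Definition superharmonic k Omega u : Prop :=
  formal_dom k u /\ forall x, Omega x -> 0 <= formal_lap k u x.

(* In the remaining definitions, functions on Omega are represented by
   functions on X of which only the values on Omega are used. *)
Definition mu_weight p k h (x : X) : R :=
  (conj_exponent p)^-1 * (h x)^-1 * sumX (fun y => `|h x - h y| * k x y)
  + p^-1 * (h x `^ (p - 1))^-1 *
    sumX (fun y => `|h x `^ (p - 1) - h y `^ (p - 1)| * k x y).

Definition Hardy_w p k h (x : X) : R :=
  (conj_exponent p)^-1 * (formal_lap k h x / h x)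
  + p^-1 * (formal_lap k (fun y => h y `^ (p - 1)) x / h x `^ (p - 1)).

Definition weighted_lp p Omega mu : set (X -> R) :=
  [set u | (forall x, ~ Omega x -> u x = 0) /\
    (\esum_(x in Omega) (`|u x| `^ p * mu x)%:E < +oo)%E].

Definition Cc Omega : set (X -> R) :=
  [set u | (forall x, ~ Omega x -> u x = 0) /\
    finite_set [set x | u x != 0]].

Definition Hardy_weight p k Omega w : Prop :=
  (forall x, Omega x -> 0 <= w x) /\
  forall u, Cc Omega u ->
    (\esum_(x in Omega) (w x * `|u x| `^ p)%:E <= SB_form p k u)%E.

End Defs.

(* Main.v *)
Require Import Defs.
From HB Require Import structures.
From mathcomp Require Import all_boot all_order all_algebra.
From mathcomp Require Import all_classical all_reals all_analysis.
From mathcomp Require Import ring lra.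

Set Implicit Arguments.
Unset Strict Implicit.
Unset Printing Implicit Defensive.

Import Order.TTheory GRing.Theory Num.Theory.

Local Open Scope classical_set_scope.
Local Open Scope ring_scope.

(** The identity holds term by term, once both sides are read as symmetrized
    double sums over [X * X].  Put
    - E(x,y) for the term of the form at [u];
    - W(x,y) for the share of the site [y] in w_h(x) |u(x)|^p, so that summing
      W(x,y) over [y] gives w_h(x) |u(x)|^p;
    - B(x,y) for 1/p times the Bregman term
      F_p(u(x)/h(x), u(y)/h(y)) h(x)^(p-1) h(y) k(x,y).
    Homogeneity of F_p clears the quotients u/h, and an elementary computation
    gives E(x,y) = W(x,y) + W(y,x) + B(x,y) + B(y,x) for all x and y
    ([picone_identity]): the mixed products of u(x) and u(y) come only from B,
    and W compensates the diagonal terms |u(x)|^p.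

    It remains to sum.  E and B are nonnegative, since F_p is nonnegative by
    Young's inequality ([Bregman_ge0], [spow_monotone]), but W has no sign.  The
    condition that u lies in l^p(mu_h) bounds the double sum of |W|, because
    mu_h is w_h with absolute values put inside the sums
    ([sum_norm_hardy_flux]).  The negative part of W then has a finite double
    sum, which can be moved across the identity and cancelled; each symmetrized
    sum is twice the plain one, and this absorbs the factor 1/2 of the form
    ([dsum_symmetrization]).

    The inequality for u in l^p(mu_h) is the identity without its nonnegative
    Bregman sum.  A finitely supported u lies in l^p(mu_h) since mu_h is finite
    at every point, whence the Hardy weight property; w_h is nonnegative by
    superharmonicity. *)

(** * Signed powers and the Bregman divergence *)

Section signed_power.
Context {R : realType}.
Implicit Types a b c p : R.

Lemma spow0 p : spow 0 p = 0.
Proof. by rewrite /spow sgr0 mulr0. Qed.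

Lemma spow_mul p a : 1 < p -> spow a (p - 1) * a = `|a| `^ p.
Proof.
move=> p1; rewrite /spow -mulrA -normrEsg mulrC.
by rewrite mulr_powRB1 ?normr_ge0//; lra.
Qed.

Lemma norm_spow p a : 1 < p -> `|spow a (p - 1)| = `|a| `^ (p - 1).
Proof.
move=> p1; rewrite /spow normrM ger0_norm ?powR_ge0// normr_sg.
by have [->|_] := eqVneq a 0; rewrite ?mulr1// normr0 powR0 ?mul0r//; lra.
Qed.

Lemma spow_div p a c : 0 < c -> spow (a / c) p = spow a p / c `^ p.
Proof.
move=> c0; rewrite /spow normrM normfV (gtr0_norm c0).
rewrite powRM ?invr_ge0 ?(ltW c0)//.
rewrite -(powR_inv1 (ltW c0)) -powRrM mulN1r powRN sgrM powR_inv1 ?(ltW c0)//.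
by rewrite sgrV (gtr0_sg c0) mulr1 mulrAC.
Qed.

(** This is convexity of |.|^p in the form of Young's inequality, applied to
    |b| and |a|^(p-1) with the exponents p and p'. *)
Lemma Bregman_ge0 p a b : 1 < p -> 0 <= Bregman p a b.
Proof.
move=> p1; have p0 : 0 < p by lra.
have q0 : 0 < p / (p - 1) by rewrite divr_gt0//; lra.
have young : `|b| * `|spow a (p - 1)| <=
    `|b| `^ p / p + `|spow a (p - 1)| `^ (p / (p - 1)) / (p / (p - 1)).
  by apply: conjugate_powR => //; field; rewrite !gt_eqF//; lra.
rewrite norm_spow// -powRrM in young.
have e : (p - 1) * (p / (p - 1)) = p by field; rewrite gt_eqF//; lra.
rewrite {}e -norm_spow// -normrM in young.
have {}young := le_trans (ler_norm _) young.
rewrite /Bregman mulrBr -(mulrA p _ a) spow_mul//.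
have := ler_wpM2l (ltW p0) young.
have -> : p * (`|b| `^ p / p + `|a| `^ p / (p / (p - 1))) =
   `|b| `^ p + (p - 1) * `|a| `^ p.
  by field; rewrite !gt_eqF//; lra.
rewrite -subr_ge0; congr (_ <= _); ring.
Qed.

(** The powers |a|^p and |b|^p cancel under symmetrization, which is how the
    Bregman divergence produces the summand of the Sobolev-Bregman form. *)
Lemma Bregman_sym p a b : 1 < p ->
  Bregman p a b + Bregman p b a =
  p * ((a - b) * (spow a (p - 1) - spow b (p - 1))).
Proof. by move=> p1; rewrite /Bregman -!spow_mul//; ring. Qed.

Lemma spow_monotone p a b : 1 < p ->
  0 <= (a - b) * (spow a (p - 1) - spow b (p - 1)).
Proof.
move=> p1; rewrite -(pmulr_rge0 _ (lt_trans ltr01 p1)) -Bregman_sym//.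
by rewrite addr_ge0 ?Bregman_ge0.
Qed.

End signed_power.

(** * Sums of nonnegative extended real families *)

Section extended_sums.
Context {R : realType}.

(** One inequality holds for each finite partial sum; the other one is the
    first for the constant 1/c and the family c f. *)
Lemma esum_mull (T : choiceType) (D : set T) (c : R) (f : T -> \bar R) :
  0 <= c -> (forall i, (0 <= f i)%E) ->
  (\esum_(i in D) (c%:E * f i) = c%:E * \esum_(i in D) f i)%E.
Proof.
move=> c0 f0.
have half (d : R) (g : T -> \bar R) : 0 <= d -> (forall i, (0 <= g i)%E) ->
    (\esum_(i in D) (d%:E * g i) <= d%:E * \esum_(i in D) g i)%E.
  move=> d0 g0; apply: ge_ereal_sup => _ [A [finA AD] <-].
  rewrite -ge0_mule_fsumr//; apply: lee_pmul => //.
    by apply: fsume_ge0 => i _.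
  by apply: esum_ge; exists A.
have [->|c_neq0] := eqVneq c 0.
  by rewrite mul0e esum1// => i _; rewrite mul0e.
have cV0 : 0 <= c^-1 by rewrite invr_ge0.
apply/eqP; rewrite eq_le half//=.
have -> : (\esum_(i in D) f i = \esum_(i in D) (c^-1%:E * (c%:E * f i)))%E.
  by apply: eq_esum => i _; rewrite muleA -EFinM mulVf// mul1e.
apply: (le_trans (lee_wpmul2l _ (half _ _ cV0 _))); rewrite ?lee_fin//.
  by move=> i; rewrite mule_ge0.
by rewrite muleA -EFinM divff// mul1e.
Qed.

Lemma exchange_esum (T U : choiceType) (f : T -> U -> \bar R) :
  (forall x y, (0 <= f x y)%E) ->
  (\esum_(x in [set: T]) \esum_(y in [set: U]) f x y =
   \esum_(y in [set: U]) \esum_(x in [set: T]) f x y)%E.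
Proof.
move=> f0; rewrite !esum_esum//.
rewrite (reindex_esum ([set: U] `*`` fun=> [set: T]) _ (fun z => (z.2, z.1)))//.
split=> [[y x]//|[y x] [y' x'] _ _ [-> ->]//|[x y] _].
by exists (y, x).
Qed.

End extended_sums.

(** * Absolutely summable real families *)

Section real_sums.
Context {R : realType} {X : countType}.
Implicit Types f g : X -> R.

Local Notation summableR f := (summable [set: X] (fun y => (f y)%:E)).

Lemma summable_lincomb (a b : R) f g : summableR f -> summableR g ->
  summableR (fun y => a * f y + b * g y).
Proof.
have scale (c : R) (u : X -> R) : summableR u -> summableR (fun y => c * u y).
  move=> us; rewrite /summable.
  under eq_esum do rewrite EFinM abseM.
  rewrite esum_mull//.
  by apply: lte_mul_pinfty.
by move=> fs gs; exact: summableD (scale a f fs) (scale b g gs).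
Qed.

Lemma le_summable f g : (forall y, `|f y| <= `|g y|) ->
  summableR g -> summableR f.
Proof.
move=> fg; apply: le_lt_trans; apply: le_esum => y _ /=.
by rewrite lee_fin.
Qed.

Lemma summable_fin_num f : (forall y, 0 <= f y) -> summableR f ->
  (\esum_(y in [set: X]) (f y)%:E)%E \is a fin_num.
Proof.
move=> f0; rewrite summableE => fs.
by rewrite -(eq_esum (fun y _ => gee0_abs (f0 y : (0 <= (f y)%:E)%E))).
Qed.

(** The value of [sumX] can be read off any decomposition into nonnegative
    summable families, so that the positive and negative parts of a linear
    combination need not be computed. *)
Lemma sumX_sub f g : (forall y, 0 <= f y) -> (forall y, 0 <= g y) ->
  summableR f -> summableR g ->
  ((sumX (fun y => f y - g y))%:E =
   \esum_(y in [set: X]) (f y)%:E - \esum_(y in [set: X]) (g y)%:E)%E.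
Proof.
move=> f0 g0 fs gs.
rewrite -(esumB fs gs) => [|y _|y _]; rewrite ?lee_fin//.
have sD := summableB fs gs.
have fin_pos : (\esum_(y in [set: X])
    ((fun y => (f y)%:E) \- (fun y => (g y)%:E))%E^\+ y)%E \is a fin_num.
  have := summable_funepos sD; rewrite summableE.
  by rewrite (eq_esum (fun y _ => gee0_abs (funepos_ge0 _ y))).
have fin_neg : (\esum_(y in [set: X])
    ((fun y => (f y)%:E) \- (fun y => (g y)%:E))%E^\- y)%E \is a fin_num.
  have := summable_funeneg sD; rewrite summableE.
  by rewrite (eq_esum (fun y _ => gee0_abs (funeneg_ge0 _ y))).
by rewrite -(fineK fin_pos) -(fineK fin_neg) -EFinB.
Qed.

Lemma sumX_ge0 f : (forall y, 0 <= f y) -> summableR f ->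
  ((sumX f)%:E = \esum_(y in [set: X]) (f y)%:E)%E.
Proof.
move=> f0 fs; have zs : summableR (fun=> 0 : R).
  by rewrite /summable esum1// => y _; rewrite abse0.
have := sumX_sub f0 (fun=> lexx 0) fs zs.
by rewrite [X in (_ - X)%E]esum1// sube0; under eq_fun do rewrite subr0.
Qed.

Lemma summable_funrpos f : summableR f -> summableR f^\+.
Proof.
apply: le_summable => y; rewrite ger0_norm ?funrpos_ge0//.
by rewrite -[leRHS]/((Num.norm \o f) y) -funrposDneg lerDl funrneg_ge0.
Qed.

Lemma summable_funrneg f : summableR f -> summableR f^\-.
Proof.
apply: le_summable => y; rewrite ger0_norm ?funrneg_ge0//.
by rewrite -[leRHS]/((Num.norm \o f) y) -funrposDneg lerDr funrpos_ge0.
Qed.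

Lemma sumX_funrposneg f : summableR f ->
  ((sumX f)%:E = \esum_(y in [set: X]) (f^\+ y)%:E
     - \esum_(y in [set: X]) (f^\- y)%:E)%E.
Proof.
move=> fs; rewrite -sumX_sub//.
- by rewrite -[in LHS](funrposBneg f).
- exact: summable_funrpos.
- exact: summable_funrneg.
Qed.

Lemma sumX_lincomb (a b : R) f g : 0 <= a -> 0 <= b ->
  summableR f -> summableR g ->
  sumX (fun y => a * f y + b * g y) = a * sumX f + b * sumX g.
Proof.
move=> a0 b0 fs gs; have esum_lincomb u v :
    (forall y, 0 <= u y) -> (forall y, 0 <= v y) ->
    (\esum_(y in [set: X]) (a * u y + b * v y)%:E =
     a%:E * (\esum_(y in [set: X]) (u y)%:E)
     + b%:E * \esum_(y in [set: X]) (v y)%:E)%E.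
  move=> u0 v0; rewrite -!esum_mull//.
  by rewrite -esumD// => y _; rewrite lee_fin mulr_ge0.
have fp := summable_funrpos fs; have fn := summable_funrneg fs.
have gp := summable_funrpos gs; have gn := summable_funrneg gs.
have -> : (fun y => a * f y + b * g y) =
    (fun y => (a * f^\+ y + b * g^\+ y) - (a * f^\- y + b * g^\- y)).
  apply/funext => y; rewrite -{1}(funrposBneg f) -{1}(funrposBneg g).
  by rewrite !fctE /=; ring.
apply: EFin_inj; rewrite sumX_sub; last first.
- exact: summable_lincomb.
- exact: summable_lincomb.
- by move=> y; rewrite addr_ge0// mulr_ge0.
- by move=> y; rewrite addr_ge0// mulr_ge0.
rewrite EFinD !EFinM !sumX_funrposneg// !esum_lincomb//.
rewrite -(fineK (summable_fin_num (funrpos_ge0 f) fp)).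
rewrite -(fineK (summable_fin_num (funrneg_ge0 f) fn)).
rewrite -(fineK (summable_fin_num (funrpos_ge0 g) gp)).
rewrite -(fineK (summable_fin_num (funrneg_ge0 g) gn)).
by congr EFin; ring.
Qed.

End real_sums.

(** * Symmetrization of double sums *)

Section symmetrization.
Context {R : realType} {X : countType}.
Implicit Types f : X -> X -> R.

Definition dsum f : \bar R :=
  (\esum_(x in [set: X]) \esum_(y in [set: X]) (f x y)%:E)%E.

Lemma dsum_ge0 f : (forall x y, 0 <= f x y) -> (0 <= dsum f)%E.
Proof.
by move=> f0; apply: esum_ge0 => x _; apply: esum_ge0 => y _; rewrite lee_fin.
Qed.

Lemma dsumD f1 f2 : (forall x y, 0 <= f1 x y) -> (forall x y, 0 <= f2 x y) ->
  (dsum (fun x y => f1 x y + f2 x y)%R = dsum f1 + dsum f2)%E.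
Proof.
move=> f10 f20; rewrite /dsum -esumD.
- by apply: eq_esum => x _; rewrite -esumD// => y _; rewrite lee_fin.
- by move=> x _; apply: esum_ge0 => y _; rewrite lee_fin.
- by move=> x _; apply: esum_ge0 => y _; rewrite lee_fin.
Qed.

Lemma dsum_symmetrize f : (forall x y, 0 <= f x y) ->
  (dsum (fun x y => f x y + f y x)%R = dsum f + dsum f)%E.
Proof.
move=> f0; rewrite dsumD//; congr (_ + _)%E.
by rewrite /dsum exchange_esum// => x y; rewrite lee_fin.
Qed.

(** An unsigned, absolutely summable part [W] of a symmetric decomposition may
    be summed row by row.  No finiteness of [E] or [B] is assumed: writing
    W = P - N with nonnegative P and N turns the hypothesis into an equality of
    nonnegative families, and only the finite double sum of N is cancelled. *)
Lemma dsum_symmetrization (E W B : X -> X -> R) :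
  (forall x y, 0 <= E x y) -> (forall x y, 0 <= B x y) ->
  (dsum (fun x y => `|W x y|%R) < +oo)%E ->
  (forall x, 0 <= sumX (W x)) ->
  (forall x y, E x y = (W x y + W y x) + (B x y + B y x)) ->
  ((2^-1)%:E * dsum E =
   \esum_(x in [set: X]) (sumX (W x))%:E + dsum B)%E.
Proof.
move=> E0 B0 Wfin sW0 EWB.
have Ws x : summable [set: X] (fun y => (W x y)%:E).
  have := @summable_pinfty X R [set: X]
    (fun x => \esum_(y in [set: X]) `|W x y|%:E)%E _ x I.
  rewrite gee0_abs; first by apply; rewrite /summable; under eq_esum do
    rewrite gee0_abs ?esum_ge0//.
  exact: esum_ge0.
pose P x y := (W x)^\+ y; pose N x y := (W x)^\- y.
have P0 x y : 0 <= P x y by exact: funrpos_ge0.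
have N0 x y : 0 <= N x y by exact: funrneg_ge0.
have WPN x y : W x y = P x y - N x y by rewrite -[in LHS](funrposBneg (W x)).
have Nfin : dsum N \is a fin_num.
  rewrite ge0_fin_numE ?dsum_ge0//; apply: le_lt_trans Wfin.
  apply: le_esum => x _; apply: le_esum => y _; rewrite lee_fin.
  by rewrite -[leRHS]/((Num.norm \o W x) y) -funrposDneg lerDr.
have dsumP : (dsum P = \esum_(x in [set: X]) (sumX (W x))%:E + dsum N)%E.
  rewrite /dsum -esumD; last 2 first.
  - by move=> x _; rewrite lee_fin.
  - by move=> x _; apply: esum_ge0 => y _; rewrite lee_fin.
  apply: eq_esum => x _; rewrite sumX_funrposneg// subeK//.
  exact: summable_fin_num (N0 x) (summable_funrneg (Ws x)).
have balance : (dsum E + (dsum N + dsum N) =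
    (dsum P + dsum P) + (dsum B + dsum B))%E.
  rewrite -!dsum_symmetrize// -!dsumD//.
  - congr dsum; apply/funext => x; apply/funext => y.
    by rewrite EWB !WPN; ring.
  - by move=> x y; rewrite addr_ge0.
  - by move=> x y; rewrite addr_ge0.
  - by move=> x y; rewrite addr_ge0.
have sum0 : (0 <= \esum_(x in [set: X]) (sumX (W x))%:E)%E.
  by apply: esum_ge0 => x _; rewrite lee_fin.
have := dsum_ge0 E0; have := dsum_ge0 B0.
move: balance sum0; rewrite dsumP -(fineK Nfin).
(* If one of the sums of E, B and W is infinite, the balance decides which
   others are; if all are finite, the claim is linear arithmetic. *)
move: (dsum E) (dsum B) (esum _ _) (fine _) => [e||] [b||] [s||] n //=.
- move=> [] ens _ _ _; rewrite -EFinM -EFinD; congr EFin.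
  lra.
- rewrite gt0_muley ?lte_fin//.
- rewrite gt0_muley ?lte_fin//.
- rewrite gt0_muley ?lte_fin//.
Qed.

End symmetrization.

(** * The ground state representation *)

Section ground_state.
Context {R : realType} {X : countType}.
Variables (k : X -> X -> R) (p : R) (Omega : set X) (h : X -> R).
Hypotheses (k_ge0 : kernel_nonneg k) (k_sym : kernel_symmetric k)
  (k_sum : kernel_summable k) (p_gt1 : 1 < p) (h_ge0 : forall x, 0 <= h x)
  (h_gt0 : forall x, Omega x -> 0 < h x)
  (h_out : forall x, ~ Omega x -> h x = 0)
  (h_dom : formal_dom k h) (hp_dom : formal_dom k (fun x => h x `^ (p - 1))).

(** The share of [y] in w_h(x) |u(x)|^p.  The nonnegative factors depending on
    [x] alone are kept in front of each gap so that its row sums are those of a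
    linear combination of two families. *)
Definition hardy_flux (u : X -> R) (x y : X) : R :=
  (conj_exponent p)^-1 * (`|u x| `^ p / h x) * ((h x - h y) * k x y)
  + p^-1 * (`|u x| `^ p / h x `^ (p - 1))
    * ((h x `^ (p - 1) - h y `^ (p - 1)) * k x y).

Definition bregman_density (u : X -> R) (x y : X) : R :=
  Bregman p (u x / h x) (u y / h y) * h x `^ (p - 1) * h y * k x y.

Let p_gt0 : 0 < p. Proof. exact: lt_trans p_gt1. Qed.

Let q_ge0 : 0 <= (conj_exponent p)^-1.
Proof. by rewrite invr_ge0 divr_ge0 ?ltW// subr_gt0. Qed.

Lemma summable_gap (v : X -> R) x : formal_dom k v ->
  summable [set: X] (fun y => (`|v x - v y| * k x y)%:E).
Proof.
move=> v_dom; apply: le_summable (summable_lincomb `|v x| 1 (k_sum x) (v_dom x)).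
move=> y; rewrite mul1r (mulrC (k x y)) -mulrDl !normrM normr_id.
by rewrite ler_wpM2r ?normr_ge0// [leRHS]ger0_norm ?addr_ge0// ler_normB.
Qed.

Lemma bregman_density_ge0 u x y : 0 <= bregman_density u x y.
Proof. by rewrite !mulr_ge0// ?Bregman_ge0 ?powR_ge0. Qed.

(** Outside [Omega] both u and h vanish, and the quotients by 0 are 0: if x lies
    in [Omega] and y does not, both sides reduce to |u(x)|^p k(x,y), carried by
    the flux from x.  Inside [Omega] the signed power of u/h factors and the
    identity becomes rational in u, h and their powers. *)
Lemma picone_identity u x y : (forall z, ~ Omega z -> u z = 0) ->
  (u x - u y) * (spow (u x) (p - 1) - spow (u y) (p - 1)) * k x y =
  (hardy_flux u x y + hardy_flux u y x)
  + (p^-1 * bregman_density u x y + p^-1 * bregman_density u y x).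
Proof.
move=> u_out; have p1 : p - 1 != 0 by rewrite gt_eqF// subr_gt0.
have pN0 : p != 0 by rewrite gt_eqF.
rewrite /hardy_flux /bregman_density /Bregman /conj_exponent.
rewrite -!spow_mul// (k_sym y x).
have out z : ~ Omega z -> [/\ u z = 0, h z = 0 & spow (u z) (p - 1) = 0].
  by move=> Oz; split; rewrite ?h_out ?u_out ?spow0.
have [/h_gt0 hx|/out[-> -> ->]] := pselect (Omega x);
have [/h_gt0 hy|/out[-> -> ->]] := pselect (Omega y).
- rewrite !spow_div//; have := gt_eqF (powR_gt0 (p - 1) hx).
  have := gt_eqF (powR_gt0 (p - 1) hy).
  move: (spow _ _) (spow _ _) (h x `^ _) (h y `^ _) => a b c d dN0 cN0.
  by field; rewrite p1 pN0 cN0 dN0 !gt_eqF.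
- rewrite !mul0r !spow0 powR0// spow_div//.
  have := gt_eqF (powR_gt0 (p - 1) hx); move: (spow _ _) (h x `^ _) => a c cN0.
  by field; rewrite p1 pN0 cN0 gt_eqF.
- rewrite !mul0r !spow0 powR0// spow_div//.
  have := gt_eqF (powR_gt0 (p - 1) hy); move: (spow _ _) (h y `^ _) => a c cN0.
  by field; rewrite p1 pN0 cN0 gt_eqF.
- by rewrite !mul0r spow0 powR0//; ring.
Qed.

Let coef_ge0 (u : X -> R) x : 0 <= (conj_exponent p)^-1 * (`|u x| `^ p / h x).
Proof. by rewrite mulr_ge0// divr_ge0// powR_ge0. Qed.

Let coefp_ge0 (u : X -> R) x : 0 <= p^-1 * (`|u x| `^ p / h x `^ (p - 1)).
Proof. by rewrite mulr_ge0 ?invr_ge0 ?(ltW p_gt0)// divr_ge0 ?powR_ge0. Qed.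

Lemma sumX_hardy_flux u x :
  sumX (hardy_flux u x) = Hardy_w p k h x * `|u x| `^ p.
Proof.
have gap v : formal_dom k v ->
    summable [set: X] (fun y => ((v x - v y) * k x y)%:E).
  move/(summable_gap x); apply: le_summable => y.
  by rewrite !normrM normr_id.
rewrite /hardy_flux sumX_lincomb//; last 2 first.
- exact: gap.
- exact: (gap (fun y => h y `^ (p - 1))).
by rewrite /Hardy_w /formal_lap; ring.
Qed.

(** By the triangle inequality for the two gaps; this is where the shape of
    mu_h comes from. *)
Lemma sum_norm_hardy_flux u x :
  (\esum_(y in [set: X]) `|hardy_flux u x y|%:E
   <= (`|u x| `^ p * mu_weight p k h x)%:E)%E.
Proof.
have sh := summable_gap x h_dom; have shp := summable_gap x hp_dom.
have -> : `|u x| `^ p * mu_weight p k h x = sumX (fun y =>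
    (conj_exponent p)^-1 * (`|u x| `^ p / h x) * (`|h x - h y| * k x y)
    + p^-1 * (`|u x| `^ p / h x `^ (p - 1))
      * (`|h x `^ (p - 1) - h y `^ (p - 1)| * k x y)).
  by rewrite sumX_lincomb// /mu_weight; ring.
rewrite sumX_ge0; last 2 first.
- by move=> y; rewrite addr_ge0// mulr_ge0// mulr_ge0// normr_ge0.
- exact: summable_lincomb.
apply: le_esum => y _; rewrite lee_fin (le_trans (ler_normD _ _))//.
rewrite !(normrM (_ * (_ / _))) (ger0_norm (coef_ge0 u x)).
rewrite (ger0_norm (coefp_ge0 u x)) !(normrM _ (k x y)).
by rewrite (ger0_norm (k_ge0 x y)).
Qed.

(** Superharmonicity enters only through the sign of w_h, which makes the row
    sums of the flux nonnegative. *)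
Lemma SB_form_ground_state u : weighted_lp p Omega (mu_weight p k h) u ->
  (forall x, Omega x -> 0 <= Hardy_w p k h x) ->
  (SB_form p k u =
     \esum_(x in Omega) (Hardy_w p k h x * `|u x| `^ p)%:E
     + (p^-1)%:E * \esum_(z in Omega `*` Omega)
         (Bregman p (u z.1 / h z.1) (u z.2 / h z.2)
          * h z.1 `^ (p - 1) * h z.2 * k z.1 z.2)%:E)%E.
Proof.
move=> [u_out u_fin] w0.
have vanish x (c : R) : ~ Omega x -> c * `|u x| `^ p = 0.
  by move=> Ox; rewrite u_out// normr0 powR0 ?mulr0// gt_eqF.
have pV0 : 0 <= p^-1 by rewrite invr_ge0 ltW.
have -> : (\esum_(x in Omega) (Hardy_w p k h x * `|u x| `^ p)%:E =
    \esum_(x in [set: X]) (sumX (hardy_flux u x))%:E)%E.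
  rewrite esum_mkcond; apply: eq_esum => x _; rewrite sumX_hardy_flux.
  by case: ifPn => // /negP; rewrite inE => Ox; rewrite vanish.
have -> : ((p^-1)%:E * (\esum_(z in Omega `*` Omega)
      (Bregman p (u z.1 / h z.1) (u z.2 / h z.2)
       * h z.1 `^ (p - 1) * h z.2 * k z.1 z.2)%:E) =
    dsum (fun x y => p^-1 * bregman_density u x y)%R)%E.
  rewrite -esum_mull//; last by move=> z; rewrite lee_fin bregman_density_ge0.
  rewrite /dsum esum_esum; last first.
    by move=> x y _ _; rewrite lee_fin mulr_ge0// bregman_density_ge0.
  rewrite esum_mkcond [RHS](_ : _ = \esum_(z in [set: X * X])
    (p^-1 * bregman_density u z.1 z.2)%:E)%E; last first.
    by congr esum; apply/seteqP; split.
  apply: eq_esum => -[x y] _ /=; rewrite -EFinM.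
  case: ifPn => // /negP; rewrite inE /= => Oxy.
  (* The factor h(x)^(p-1) h(y) kills all pairs that are not in Omega x Omega. *)
  rewrite /bregman_density; congr EFin.
  have [Ox|/h_out hx] := pselect (Omega x); last first.
    by rewrite hx powR0 ?mulr0 ?mul0r ?mulr0// gt_eqF// subr_gt0.
  have [Oy|/h_out hy] := pselect (Omega y); first by case: Oxy.
  by rewrite hy mulr0 !mul0r mulr0.
apply: dsum_symmetrization.
- by move=> x y; rewrite mulr_ge0// spow_monotone.
- by move=> x y; rewrite mulr_ge0// bregman_density_ge0.
- apply: le_lt_trans u_fin; rewrite [leRHS]esum_mkcond; apply: le_esum => x _.
  apply: le_trans (sum_norm_hardy_flux u x) _.
  by case: ifPn => // /negP; rewrite inE => Ox; rewrite mulrC vanish.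
- move=> x; rewrite sumX_hardy_flux.
  have [Ox|Ox] := pselect (Omega x); last by rewrite vanish.
  by rewrite mulr_ge0 ?powR_ge0// w0.
- by move=> x y; exact: picone_identity.
Qed.

(** mu_h takes finite values because h and h^(p-1) lie in the formal domain and
    k is summable. *)
Lemma Cc_weighted_lp u : Cc Omega u -> weighted_lp p Omega (mu_weight p k h) u.
Proof.
move=> [u_out u_fin]; split=> //.
have term0 x : (0 <= (`|u x| `^ p * mu_weight p k h x)%:E)%E.
  by apply: le_trans (sum_norm_hardy_flux u x); apply: esum_ge0.
apply: (@le_lt_trans _ _ (\esum_(x in [set x | u x != 0%R])
    (`|u x| `^ p * mu_weight p k h x)%:E)%E).
  rewrite [leLHS]esum_mkcond [leRHS]esum_mkcond; apply: le_esum => x _.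
  have [ux0|ux] := eqVneq (u x) 0.
    by rewrite ux0 normr0 powR0 ?gt_eqF// mul0r !if_same.
  by rewrite [in leRHS]mem_set//; case: ifP => // _; exact: term0.
rewrite esum_fset//.
by rewrite fsumEFin// ltry.
Qed.

End ground_state.

Theorem theorem2p4 (R : realType) (X : countType) (k : X -> X -> R)
    (k_ge0 : kernel_nonneg k) (k_sym : kernel_symmetric k)
    (k_sum : kernel_summable k)
    (p : R) (p_gt1 : 1 < p) (Omega : set X) (h : X -> R)
    (h_ge0 : forall x, 0 <= h x)
    (h_gt0 : forall x, Omega x -> 0 < h x)
    (h_out : forall x, ~ Omega x -> h x = 0)
    (h_super : superharmonic k Omega h)
    (hp_super : superharmonic k Omega (fun x => h x `^ (p - 1))) :
  [/\ forall u : X -> R, weighted_lp p Omega (mu_weight p k h) u ->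
        (SB_form p k u =
         \esum_(x in Omega) (Hardy_w p k h x * `|u x| `^ p)%:E
         + (p^-1)%:E * \esum_(z in Omega `*` Omega)
             (Bregman p (u z.1 / h z.1) (u z.2 / h z.2)
              * h z.1 `^ (p - 1) * h z.2 * k z.1 z.2)%:E)%E,
      Hardy_weight p k Omega (Hardy_w p k h)
    & forall u : X -> R, weighted_lp p Omega (mu_weight p k h) u ->
        (\esum_(x in Omega) (Hardy_w p k h x * `|u x| `^ p)%:E
         <= SB_form p k u)%E].
Proof.
have h_dom := h_super.1; have hp_dom := hp_super.1.
have w_ge0 x : Omega x -> 0 <= Hardy_w p k h x.
  move=> Ox; rewrite addr_ge0// mulr_ge0//.
  - by rewrite invr_ge0 divr_ge0//; lra.
  - by rewrite divr_ge0// h_super.2.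
  - by rewrite invr_ge0; lra.
  - by rewrite divr_ge0 ?powR_ge0// hp_super.2.
have identity u : weighted_lp p Omega (mu_weight p k h) u -> _ :=
  fun u_lp => SB_form_ground_state k_ge0 k_sym k_sum p_gt1 h_ge0 h_gt0 h_out
    h_dom hp_dom u_lp w_ge0.
have inequality u : weighted_lp p Omega (mu_weight p k h) u ->
    (\esum_(x in Omega) (Hardy_w p k h x * `|u x| `^ p)%:E
     <= SB_form p k u)%E.
  move=> /identity ->; apply: leeDl; apply: mule_ge0.
    by rewrite lee_fin invr_ge0; lra.
  apply: esum_ge0 => z _; rewrite lee_fin.
  exact: bregman_density_ge0.
split=> //; split=> // u /Cc_weighted_lp u_lp.
exact/inequality/u_lp.
Qed.
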